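(* Let $K$ be a finite simplicial complex, let $k\ge0$, and let $W_{k-1},W_k,W_{k+1}$ be positive definite diagonal matrices indexed by the $(k-1)$-, $k$- and $(k+1)$-simplices of $K$ respectively. Let $$\Delta_k^W=W_k^{-1}d_k^{T}W_{k+1}d_k+d_{k-1}W_{k-1}^{-1}d_{k-1}^{T}W_k$$ be the weighted Hodge Laplacian on $C^k(K)$. Then $$\dim\ker\Delta_k^W=\dim H^k(K;\mathbb{R})=\beta_k(K).$$ In particular, the kernel dimension is independent of the choice of positive weights.
   Context: $K_k$ denotes the set of (oriented) $k$-simplices of $K$, and $C^k(K)$ the real vector space of simplicial $k$-cochains, identified with column vectors in $\mathbb{R}^{K_k}$. Weight matrices have the form $W_k=\mathrm{diag}\{w_k(\sigma):\sigma\in K_k\}$ with all $w_k(\sigma)>0$. The map $d_k:C^k(K)\to C^{k+1}(K)$ is the simplicial coboundary operator, written as a matrix in the standard bases, and $H^k(K;\mathbb{R})=\ker d_k/\operatorname{im}d_{k-1}$ is (unreduced) simplicial cohomology. $\beta_k(K)=\dim H_k(K;\mathbb{R})$ is the $k$th Betti number, the dimension of real simplicial homology. Convention: $C^{-1}(K)=0$, so for $k=0$ the second term of $\Delta_k^W$ is zero; likewise the first term is zero if $K$ has no $(k+1)$-simplices. *)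

(* Defs.v *)
From HB Require Import structures.
From mathcomp Require Import all_boot all_order all_algebra generic_quotient.
From mathcomp Require Import ring_quotient reals.

Set Implicit Arguments.
Unset Strict Implicit.
Unset Printing Implicit Defensive.

Import GRing.Theory Num.Theory.

Local Open Scope ring_scope.
Local Open Scope quotient_scope.

(* The quotient vector space E / S: the library's quotient of the additive
   group E by S, equipped with the induced scaling. *)
Section VectorQuotient.
Variables (F : fieldType) (E : vectType F) (S : {vspace E}).

Definition vquot : Type := Quotient.quot (pred_of_vspace S).

HB.instance Definition _ := GRing.Zmodule.on vquot.

Definition vquot_pi (u : E) : vquot := \pi_(Quotient.quot (pred_of_vspace S)) u.
Definition vquot_repr (q : vquot) : E :=
  repr (q : Quotient.quot (pred_of_vspace S)).

Lemma vquot_reprK : cancel vquot_repr vquot_pi.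
Proof. exact: reprK. Qed.

Lemma vquot_piP u v : vquot_pi u = vquot_pi v <-> u - v \in S.
Proof. by rewrite [u - v \in S]Quotient.idealrBE; split=> /eqP. Qed.

Lemma vquot_piD : {morph vquot_pi : u v / u + v}.
Proof. exact: pi_addr. Qed.

Definition vquot_scale (a : F) (q : vquot) : vquot :=
  vquot_pi (a *: vquot_repr q).

Lemma vquot_piZ a u : vquot_pi (a *: u) = vquot_scale a (vquot_pi u).
Proof.
apply/vquot_piP; rewrite -scalerBr rpredZ //.
by apply/vquot_piP; rewrite vquot_reprK.
Qed.

Fact vquot_scaleA a b q :
  vquot_scale a (vquot_scale b q) = vquot_scale (a * b) q.
Proof. by rewrite -[q]vquot_reprK -!vquot_piZ scalerA. Qed.

Fact vquot_scale1 : left_id 1 vquot_scale.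
Proof. by move=> q; rewrite -[q]vquot_reprK -!vquot_piZ scale1r. Qed.

Fact vquot_scaleDr : right_distributive vquot_scale +%R.
Proof.
move=> a p q; rewrite -[p]vquot_reprK -[q]vquot_reprK -vquot_piD -!vquot_piZ.
by rewrite scalerDr vquot_piD.
Qed.

Fact vquot_scaleDl q : {morph vquot_scale^~ q : a b / a + b}.
Proof.
by move=> a b; rewrite -[q]vquot_reprK -!vquot_piZ scalerDl vquot_piD.
Qed.

HB.instance Definition _ := GRing.Zmodule_isLmodule.Build F vquot
  vquot_scaleA vquot_scale1 vquot_scaleDr vquot_scaleDl.

Fact vquot_pi_is_linear : linear vquot_pi.
Proof. by move=> a u v; rewrite vquot_piD vquot_piZ. Qed.
HB.instance Definition _ := GRing.isSemilinear.Build F E vquot _ vquot_pi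
  (GRing.semilinear_linear vquot_pi_is_linear).

Fact vquot_vect_iso : Vector.axiom (\dim (S^C)%VS) vquot.
Proof.
pose p u := u - projv S u; pose b := vbasis (S^C)%VS.
have p_lin a u v : p (a *: u + v) = a *: p u + p v.
  by rewrite /p linearP scalerBr opprD addrACA.
have p_pi u : p (vquot_repr (vquot_pi u)) = p u.
  have: vquot_repr (vquot_pi u) - u \in S.
    by apply/vquot_piP; rewrite vquot_reprK.
  move/projv_id; rewrite linearB /= /p => e.
  apply/eqP; rewrite subr_eq addrAC -addrA e addrC subrK //.
exists (fun q => \row_i coord b i (p (vquot_repr q))).
  move=> a q r; apply/rowP=> i; rewrite !mxE -linearP -p_lin.
  by rewrite -{1}[q]vquot_reprK -{1}[r]vquot_reprK -linearP p_pi.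
exists (fun x : 'rV_(\dim (S^C)%VS) => vquot_pi (\sum_i x 0 i *: b`_i)).
  move=> q /=; rewrite -[RHS]vquot_reprK; apply/vquot_piP.
  have -> : \sum_i (\row_j coord b j (p (vquot_repr q))) 0 i *: b`_i
            = p (vquot_repr q).
    rewrite [RHS](coord_vbasis (memv_projC S _)).
    by apply: eq_bigr => i _; rewrite mxE.
  by rewrite /p addrAC subrr sub0r rpredN memv_proj.
move=> x; apply/rowP=> i; rewrite mxE p_pi /p.
set u := \sum_i _.
have uC : u \in (S^C)%VS.
  by apply: rpred_sum => j _; rewrite rpredZ ?vbasis_mem ?memt_nth.
have -> : projv S u = 0.
  by apply/eqP; rewrite -memv_ker lker_proj.
by rewrite subr0 coord_sum_free ?(basis_free (vbasisP _)).
Qed.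

HB.instance Definition _ := Lmodule_hasFinDim.Build F vquot vquot_vect_iso.

Lemma dim_vquot : \dim {: vquot} = (\dim {: E} - \dim S)%N.
Proof. by rewrite dimvf -dimv_compl. Qed.

End VectorQuotient.

(* ker g / im f, for composable f and g with g \o f = 0; in general im f is
   replaced by its intersection with ker g. *)
Definition homology_space (F : fieldType) (A B C : vectType F)
    (f : 'Hom(A, B)) (g : 'Hom(B, C)) : vectType F :=
  vquot (linfun (vsval : subvs_of (lker g) -> B) @^-1: limg f)%VS.

Definition mxfun (F : fieldType) (m n : nat) (A : 'M[F]_(m, n)) :
    'Hom('cV[F]_n, 'cV[F]_m) :=
  linfun (mulmx A).

Section SimplicialComplex.
Variables (V : finType) (K : {set {set V}}).

Definition simplicial_complex : Prop :=
  set0 \notin K /\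
  forall s t : {set V}, s \in K -> t \subset s -> t != set0 -> t \in K.

(* Simplices are graded by their number of vertices: [simplices k.+1] is K_k,
   and [simplices 0] plays the role of K_{-1}, which is empty as set0 is not a
   simplex.  This makes C^{-1} = 0 without a special case. *)
Definition simplices (m : nat) : {set {set V}} := [set s in K | #|s| == m].

(* An orientation of each simplex is given by a chosen ordering of its vertices,
   [:: v_0; ...; v_k]. *)
Definition orientation (o : {set V} -> seq V) : Prop :=
  forall s : {set V}, s \in K -> perm_eq (o s) (enum s).

End SimplicialComplex.

Section Incidence.
Variables (R : pzRingType) (V : finType).

(* The sign of the permutation relating two orderings of the same vertices,
   computed by counting inversions. *)
Definition reorder_sign (s t : seq V) : R :=
  (-1) ^+ #|[set p : V * V | (index p.1 s < index p.2 s)%N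
                           & (index p.2 t < index p.1 t)%N]|.

Definition face (i : nat) (s : seq V) : seq V := take i s ++ drop i.+1 s.

(* The incidence number [sigma : tau]: the coefficient of the oriented simplex
   tau in \sum_i (-1)^i [v_0, ..., omit v_i, ..., v_k], where
   sigma = [v_0, ..., v_k]. *)
Definition incidence (o : {set V} -> seq V) (sigma tau : {set V}) : R :=
  \sum_(i < size (o sigma) | [set x in face i (o sigma)] == tau)
     (-1) ^+ i * reorder_sign (face i (o sigma)) (o tau).

End Incidence.

Section Cochains.
Variables (R : realType) (V : finType) (K : {set {set V}}).
Variable o : {set V} -> seq V.

(* [coboundary m] is d_{m-1} : C^{m-1}(K) -> C^m(K). *)
Definition coboundary (m : nat) :
    'M[R]_(#|simplices K m.+1|, #|simplices K m|) :=
  \matrix_(i, j) incidence R o (enum_val i) (enum_val j).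

(* [boundary m] is the boundary operator C_m(K) -> C_{m-1}(K). *)
Definition boundary (m : nat) :
    'M[R]_(#|simplices K m|, #|simplices K m.+1|) :=
  \matrix_(i, j) incidence R o (enum_val j) (enum_val i).

(* H^k(K; R) = ker d_k / im d_{k-1} *)
Definition cohomology (k : nat) : vectType R :=
  homology_space (mxfun (coboundary k)) (mxfun (coboundary k.+1)).

Definition homology (k : nat) : vectType R :=
  homology_space (mxfun (boundary k.+1)) (mxfun (boundary k)).

Definition betti (k : nat) : nat := \dim {: homology k}.

Definition weight_mx (m : nat) (w : {set V} -> R) : 'M[R]_#|simplices K m| :=
  diag_mx (\row_i w (enum_val i)).

Definition positive_weight (m : nat) (w : {set V} -> R) : Prop :=
  forall s, s \in simplices K m -> 0 < w s.

(* Delta_k^W, where wp, w, wn weight the (k-1)-, k- and (k+1)-simplices. *)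
Definition hodge_laplacian (k : nat) (wp w wn : {set V} -> R) :
    'M[R]_#|simplices K k.+1| :=
  invmx (weight_mx k.+1 w) *m (coboundary k.+1)^T
    *m weight_mx k.+2 wn *m coboundary k.+1
  + coboundary k *m invmx (weight_mx k wp) *m (coboundary k)^T
    *m weight_mx k.+1 w.

End Cochains.

(* Main.v *)
(** The matrices d and d^T have the same rank, so once d \o d = 0 both homology and
    cohomology have dimension #|K_k| - rank d_k - rank d_(k-1).  If Delta x = 0,
    pairing with x through W_k gives
    (d_k x)^T W_(k+1) (d_k x) + (d_(k-1)^T W_k x)^T W_(k-1)^-1 (d_(k-1)^T W_k x) = 0,
    so ker Delta is the common kernel of d_k and d_(k-1)^T W_k; the row spaces of
    these two matrices are independent because d_k d_(k-1) = 0.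

    For d \o d = 0, let sgn s be the sign of s relative to a fixed order of the
    vertices.  The incidence number [sigma : sigma \ v] is sgn (o sigma) *
    sgn (o (sigma \ v)) times (-1)^c, with c the number of vertices of sigma
    below v.  Hence omitting v and then w contributes the opposite of omitting w
    and then v. *)
Require Import Defs.
From mathcomp Require Import all_boot all_order all_algebra reals.
From mathcomp Require Import zify ring.

Set Implicit Arguments.
Unset Strict Implicit.
Unset Printing Implicit Defensive.

Import Order.TTheory GRing.Theory Num.Theory.

Local Open Scope ring_scope.

(** * Signs of vertex orderings and incidence numbers *)

Section ReorderSign.
Variables (R : comPzRingType) (V : finType).
Implicit Types (x y v : V) (s t : seq V) (A : {set V}).

(** An auxiliary total order on the vertices, against which orderings are compared. *)
Definition vlt x y := (enum_rank x < enum_rank y)%N.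

Lemma vltNge x y : x != y -> vlt y x = ~~ vlt x y.
Proof.
move=> nxy; rewrite /vlt.
have : (enum_rank x : nat) != enum_rank y.
  by apply: contra nxy => /eqP/val_inj/enum_rank_inj->.
by case: ltngtP.
Qed.

Lemma vltxx x : vlt x x = false. Proof. exact: ltnn. Qed.

Lemma vlt_neq x y : vlt x y -> x != y.
Proof. by apply: contraTneq => ->; rewrite vltxx. Qed.

Lemma index_inj_in s x y : x \in s -> index x s = index y s -> x = y.
Proof.
move=> xs e; have ys : y \in s by rewrite -index_mem -e index_mem.
by rewrite -(nth_index x xs) e nth_index.
Qed.

(** For duplicate-free [s], the sign of the permutation sorting [s] by [vlt]. The product over pairs
    lets signs be compared factor by factor. *)
Definition seq_sign s : R :=
  \prod_(x in s) \prod_(y in s | vlt x y) (-1) ^+ (index y s < index x s)%N.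

Lemma signr_sqr (n : nat) : (-1) ^+ n * (-1) ^+ n = 1 :> R.
Proof. by rewrite -exprD addnn -signr_odd odd_double. Qed.

Lemma seq_sign_sqr s : seq_sign s * seq_sign s = 1.
Proof.
rewrite -big_split big1 //= => x _; rewrite -big_split big1 //= => y _.
exact: signr_sqr.
Qed.

(** A pair is inverted between [s] and [t] exactly when one of the two lists, but not both, inverts
    it relative to [vlt]. *)
Lemma reorder_signE s t : s =i t ->
  reorder_sign R s t = seq_sign s * seq_sign t.
Proof.
move=> st.
pose F x y := (index x s < index y s)%N && (index y t < index x t)%N.
(* A strictly smaller index forces membership in the list, so the count over [V * V] only sees
   vertices of [s]. *)
have Fs x y : F x y -> (x \in s) && (y \in s).
  case/andP=> xs yt; rewrite [y \in s]st -!index_mem.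
  by rewrite (leq_trans xs) ?(leq_trans yt) ?index_size.
have -> : reorder_sign R s t
    = \prod_(x in s) \prod_(y in s) (-1) ^+ F x y.
  rewrite /reorder_sign -prodr_const pair_big_dep /= big_mkcond /=.
  rewrite [RHS]big_mkcond; apply: eq_bigr => -[x y] _ /=; rewrite inE /= -/(F x y).
  by case: ifP => [/Fs -> //|_]; case: ifP.
(* Ordered pairs are grouped two by two, the [vlt]-smaller vertex first; the diagonal contributes
   1. *)
have -> : \prod_(x in s) \prod_(y in s) (-1) ^+ F x y
   = \prod_(x in s) \prod_(y in s | vlt x y) ((-1) ^+ F x y * (-1) ^+ F y x) :> R.
  rewrite (eq_bigr (fun x => \prod_(y in s | vlt x y) (-1) ^+ F x y
      * \prod_(y in s | vlt y x) (-1) ^+ F x y)); last first.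
    move=> x _; rewrite (bigID (vlt x)) /=; congr (_ * _).
    rewrite big_mkcond [RHS]big_mkcond; apply: eq_bigr => y _.
    have [->|nxy] := eqVneq x y; last by rewrite (vltNge nxy).
    by rewrite vltxx andbT andbF /F ltnn; case: ifP.
  rewrite big_split /= [X in _ * X](exchange_big_dep (mem s)) /=.
    rewrite -big_split; apply: eq_bigr => x xs.
    rewrite big_split; congr (_ * _); apply: eq_bigl => y.
    by rewrite xs.
  by move=> x y _ /andP[].
have eT : seq_sign t
   = \prod_(x in s) \prod_(y in s | vlt x y) (-1) ^+ (index y t < index x t)%N.
  by apply: eq_big => [x|x _]; [rewrite st|apply: eq_bigl => y; rewrite st].
rewrite eT -big_split; apply: eq_bigr => x xs.
rewrite -big_split; apply: eq_bigr => y /andP[ys] /vlt_neq nxy.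
have ns : index x s != index y s by apply: contra nxy => /eqP/(index_inj_in xs)->.
have nt : index x t != index y t.
  by apply: contra nxy => /eqP/index_inj_in -> //; rewrite -st.
rewrite /F /=; case: ltngtP ns nt => // _ _; case: ltngtP => // _ _ /=;
  by rewrite ?mulrNN ?mulr1 ?mul1r.
Qed.

Lemma index_rem_lt s v x y : uniq s -> v \in s -> x != v -> y != v ->
  x \in s -> y \in s ->
  (index x (rem v s) < index y (rem v s))%N = (index x s < index y s)%N.
Proof.
move=> us vs nx ny; case/splitPr: vs us => s1 s2.
rewrite cat_uniq /= => /and3P[_ /norP[vs1 _] _].
have -> : rem v (s1 ++ v :: s2) = s1 ++ s2.
  rewrite remE index_cat (negPf vs1) /= eqxx addn0 take_size_cat //.
  by rewrite -cat_rcons drop_size_cat // size_rcons.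
rewrite !mem_cat !inE (negPf nx) (negPf ny) /= !index_cat /=.
rewrite (eq_sym v x) (eq_sym v y) (negPf nx) (negPf ny).
move: (index_mem x s1) (index_mem y s1).
case: (x \in s1); case: (y \in s1) => //= hx hy _ _; lia.
Qed.

Definition below A v := #|[set w in A | vlt w v]|.

Lemma sign_index s v : uniq s -> v \in s ->
  (-1) ^+ index v s = \prod_(x in s | x != v) (-1) ^+ (index x s < index v s)%N :> R.
Proof.
move=> us vs.
have {1}-> : index v s = #|[pred x in s | (index x s < index v s)%N]|.
  rewrite -[LHS](@size_takel _ _ s) ?index_size //.
  rewrite -(card_uniqP (take_uniq _ us)); apply: eq_card => x.
  rewrite inE; case xs: (x \in s); first by rewrite in_take.
  by apply/negbTE; apply: contraFN xs; apply: mem_take.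
rewrite -prodr_const big_mkcond [RHS]big_mkcond; apply: eq_bigr => x _.
rewrite inE; case: (x \in s) => //=.
by have [->|_] := eqVneq x v; [rewrite ltnn|case: ltnP].
Qed.

Lemma sign_below A v :
  (-1) ^+ below A v = \prod_(x in A | x != v) (-1) ^+ vlt x v :> R.
Proof.
rewrite -prodr_const big_mkcond [RHS]big_mkcond; apply: eq_bigr => x _.
rewrite inE; case: (x \in A) => //=.
by have [->|_] := eqVneq x v; [rewrite vltxx|case: vlt].
Qed.

(* An inversion of s relative to [vlt] involving v is an x that is before v in s
   xor below v. *)
Lemma seq_sign_rem s v : uniq s -> v \in s ->
  (-1) ^+ index v s * seq_sign (rem v s)
    = seq_sign s * (-1) ^+ below [set x in s] v.
Proof.
move=> us vs; pose f x y : R := (-1) ^+ (index y s < index x s)%N.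
have mr x : (x \in rem v s) = (x \in s) && (x != v).
  by rewrite mem_rem_uniq // inE andbC.
have -> : seq_sign (rem v s)
   = \prod_(x in s | x != v) \prod_(y in s | (y != v) && vlt x y) f x y.
  apply: eq_big => [x|x]; first exact: mr.
  rewrite mr => /andP[xs nx]; apply: eq_big => [y|y]; first by rewrite mr andbA.
  by rewrite mr => /andP[/andP[ys ny] _]; rewrite index_rem_lt.
(* The pairs containing [v] are split off, according to whether [v] is the larger or the smaller
   member. *)
have -> : seq_sign s
   = (\prod_(x in s | x != v) if vlt x v then f x v else f v x)
     * \prod_(x in s | x != v) \prod_(y in s | (y != v) && vlt x y) f x y.
  rewrite /seq_sign (bigD1 v) //=.
  have -> : \prod_(y in s | vlt v y) (-1) ^+ (index y s < index v s)%N
     = \prod_(y in s | y != v) if vlt y v then 1 else f v y :> R.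
    rewrite big_mkcond [RHS]big_mkcond; apply: eq_bigr => y _.
    case: (y \in s) => //=; have [->|ny] := eqVneq y v; first by rewrite vltxx.
    by rewrite (vltNge ny); case: (vlt y v).
  rewrite -!big_split; apply: eq_bigr => x /andP[xs nx] /=.
  have -> : \prod_(y in s | vlt x y) (-1) ^+ (index y s < index x s)%N
     = (if vlt x v then f x v else 1)
       * \prod_(y in s | (y != v) && vlt x y) f x y :> R.
    rewrite (bigID (pred1 v)) /=; congr (_ * _); last first.
      by apply: eq_bigl => y; rewrite -andbA (andbC (vlt x y)).
    case: ifP => xv.
      rewrite (big_pred1 v) // => y /=.
      by have [->|_] := eqVneq y v; rewrite ?vs ?xv ?andbF.
    by rewrite big_pred0 // => y; case: eqVneq => [->|]; rewrite ?xv ?andbF.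
  by case: vlt; rewrite ?mul1r ?mulrA ?mulr1.
rewrite mulrAC sign_index // sign_below; congr (_ * _).
rewrite [X in _ = _ * X](eq_bigl (fun x => (x \in s) && (x != v))); last first.
  by move=> x; rewrite inE.
rewrite -big_split; apply: eq_bigr => x /andP[xs nx] /=; rewrite /f.
have ni : index x s != index v s by apply: contra nx => /eqP/(index_inj_in xs)->.
by case: vlt; case: ltngtP ni => //= _ _; rewrite ?mulr1 ?mul1r ?mulrNN ?mulr1.
Qed.

(** Positions in [o A] are traded for [vlt], so that the orientation enters through one sign per
    simplex. At most one [v] contributes; the sum form turns a composite into a double sum over
    vertices. *)
Lemma incidenceE (o : {set V} -> seq V) (A B : {set V}) :
  perm_eq (o A) (enum A) -> perm_eq (o B) (enum B) ->
  incidence R o A B = \sum_(v in A | A :\ v == B)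
    (-1) ^+ below A v * seq_sign (o A) * seq_sign (o B).
Proof.
move=> oA oB; have uA : uniq (o A) by rewrite (perm_uniq oA) enum_uniq.
have mA : o A =i A by move=> x; rewrite (perm_mem oA) mem_enum.
have mB : o B =i B by move=> x; rewrite (perm_mem oB) mem_enum.
have sA : [set x in o A] = A by apply/setP=> x; rewrite inE mA.
have -> : incidence R o A B = \sum_(v <- o A | A :\ v == B)
    (-1) ^+ index v (o A) * reorder_sign R (rem v (o A)) (o B).
  rewrite (big_tnth _ _ (o A)) /incidence.
  have E (i : 'I_(size (o A))) : face i (o A) = rem (tnth (in_tuple (o A)) i) (o A).
    (* The ordinal [i] supplies a vertex to serve as default for [nth]. *)
    have [v0] : exists v0 : V, True by exists (tnth (in_tuple (o A)) i).
    by rewrite remE (tnth_nth v0) index_uniq.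
  apply: eq_big => [i|i _]; last first.
    have [v0] : exists v0 : V, True by exists (tnth (in_tuple (o A)) i).
    by rewrite E (tnth_nth v0) index_uniq.
  rewrite E; congr (_ == _); apply/setP=> x.
  by rewrite !inE mem_rem_uniq // inE mA.
rewrite big_mkcond big_uniq //= -big_mkcondr; apply: eq_big => [v|v]; first by rewrite mA.
case/andP=> vA /eqP eB.
rewrite reorder_signE; last first.
  by move=> x; rewrite mem_rem_uniq // mB -eB !inE mA.
by rewrite mulrA seq_sign_rem // sA (mulrC (seq_sign _)).
Qed.

(** Omitting [a] lowers the count at [b] by one exactly when [a] is below [b]. *)
Lemma sign_belowD1 A a b : a != b -> a \in A ->
  (-1) ^+ below A b = (-1) ^+ below (A :\ a) b * (-1) ^+ vlt a b :> R.
Proof.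
move=> nab aA; rewrite -exprD; congr (_ ^+ _).
rewrite /below (cardsD1 a) !inE aA addnC; congr (_ + _)%N.
by apply: eq_card => x; rewrite !inE andbA.
Qed.

End ReorderSign.

(** * The composite of two coboundaries vanishes *)

Lemma coboundary_comp0 (R : realType) (V : finType) (K : {set {set V}})
    (o : {set V} -> seq V) (m : nat) :
  simplicial_complex K -> orientation K o ->
  coboundary R K o m.+1 *m coboundary R K o m = 0.
Proof.
move=> [K0 Kf] oK; apply/matrixP=> i j; rewrite !mxE.
under eq_bigr => l _ do rewrite !mxE.
have := enum_valP i; have := enum_valP j.
move: (enum_val i) (enum_val j) => A C.
rewrite !inE => /andP[CK cC] /andP[AK cA].
have m0 : (0 < m)%N.
  by rewrite lt0n -(eqP cC) cards_eq0; apply: contraNneq K0 => <-.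
have AT a : a \in A -> A :\ a \in simplices K m.+1.
  move=> aA; have cAa : #|A :\ a| = m.+1.
    by apply/eqP; rewrite -eqSS -(eqP cA) (cardsD1 a A) aA.
  rewrite inE cAa eqxx andbT (Kf A) ?subD1set //.
  by rewrite -card_gt0 cAa.
rewrite -(big_enum_val (A := mem (simplices K m.+1))
  (fun B => incidence R o A B * incidence R o B C)) /=.
(* The sign of omitting [a] and then [b], freed of orientations. It is antisymmetric because exactly
   one of two distinct vertices is below the other. *)
pose G a b : R := (-1) ^+ below A a * (-1) ^+ below (A :\ a) b.
have GN a b : a \in A -> b \in A -> a != b -> G b a = - G a b.
  move=> aA bA nab; rewrite /G.
  rewrite (sign_belowD1 R nab aA) (@sign_belowD1 R V A b a) 1?eq_sym //.
  by rewrite (vltNge nab); case: vlt; rewrite /= ?expr0 ?expr1; ring.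
pose S := \sum_(a in A) \sum_(b in A | (b != a) && (A :\ a :\ b == C)) G a b.
(* The sign of the intermediate simplex occurs twice and squares to 1; those of [A] and [C] factor
   out. *)
have -> : \sum_(B in simplices K m.+1) incidence R o A B * incidence R o B C
    = S * (seq_sign R (o A) * seq_sign R (o C)).
  transitivity (\sum_(B in simplices K m.+1) \sum_(a in A | A :\ a == B)
     (-1) ^+ below A a * seq_sign R (o A) * seq_sign R (o B) * incidence R o B C).
    apply: eq_bigr => B; rewrite inE => /andP[BK _].
    by rewrite (incidenceE R (oK _ AK) (oK _ BK)) mulr_suml.
  rewrite (exchange_big_dep (mem A)) /=; last by move=> ? ? _ /andP[].
  rewrite /S mulr_suml; apply: eq_bigr => a aA.
  rewrite (big_pred1 (A :\ a)); last first.
    move=> B /=; rewrite aA /= eq_sym.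
    by case: eqVneq => [->|_]; rewrite ?AT ?andbF.
  have /setIdP[BK _] := AT a aA.
  rewrite (incidenceE R (oK _ BK) (oK _ CK)) mulr_sumr mulr_suml.
  apply: eq_big => [b|b _]; first by rewrite !inE (andbC (b != a)) andbA.
  rewrite /G; have := seq_sign_sqr R (o (A :\ a)).
  move: (seq_sign _ (o (A :\ a))) => t tt.
  rewrite -!mulrA; congr (_ * _); rewrite [RHS]mulrCA; congr (_ * _).
  by rewrite mulrCA; congr (_ * _); rewrite mulrA tt mul1r.
suff S0 : S = 0 by rewrite S0 mul0r.
(* Exchanging [a] and [b] keeps the condition on the remaining face and negates [G]. *)
have SN : S = - S.
  rewrite {1}/S (exchange_big_dep (mem A)) /=; last by move=> ? ? _ /andP[].
  rewrite -sumrN; apply: eq_bigr => a aA; rewrite -sumrN.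
  apply: eq_big => [b|b].
    by rewrite aA eq_sym !setDDl setUC; case: (b \in A).
  by case/and3P=> bA _ /andP[nab _]; exact: GN.
by apply/eqP; rewrite -[_ == 0](mulrn_eq0 S 2) mulr2n {2}SN subrr.
Qed.

(** * Kernels, images and homology spaces in terms of ranks *)

Section KernelDimension.
Variable F : fieldType.

Lemma mxfunE m n (A : 'M[F]_(m, n)) x : mxfun A x = A *m x.
Proof. by rewrite lfunE. Qed.

(** In the rank factorisation of [A], the row base acts surjectively on columns and the column base
    injectively. *)
Lemma dim_limg_mxfun m n (A : 'M[F]_(m, n)) : \dim (limg (mxfun A)) = \rank A.
Proof.
have -> : mxfun A = (mxfun (col_base A) \o mxfun (row_base A))%VF.
  by apply/lfunP=> x; rewrite comp_lfunE !mxfunE mulmxA mulmx_base.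
have full : limg (mxfun (row_base A)) = fullv.
  apply/eqP; rewrite eqEsubv subvf; apply/subvP=> y _.
  have [B AB] := row_freeP (row_base_free A).
  apply/memv_imgP; exists (B *m y); first exact: memvf.
  by rewrite mxfunE mulmxA AB mul1mx.
rewrite limg_comp full limg_dim_eq; first by rewrite dimvf /dim /= muln1.
apply/eqP; rewrite capfv -subv0; apply/subvP=> y; rewrite memv_ker mxfunE.
have /row_fullP[B BA] := col_base_full A.
by move=> /eqP Ay; rewrite memv0 -[y]mul1mx -BA -mulmxA Ay mulmx0.
Qed.

Lemma dim_lker_mxfun m n (A : 'M[F]_(m, n)) :
  \dim (lker (mxfun A)) = (n - \rank A)%N.
Proof.
have := limg_ker_dim (mxfun A) fullv; rewrite capfv dim_limg_mxfun dimvf.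
by rewrite /dim /= muln1 => /(canRL (addnK _)).
Qed.

(** Since [B *m A = 0], the inclusion of ker B maps the preimage of im A isomorphically onto im
    A. *)
Lemma dim_homology_space m n p (A : 'M[F]_(n, p)) (B : 'M[F]_(m, n)) :
  B *m A = 0 ->
  \dim {: homology_space (mxfun A) (mxfun B)} = (n - \rank B - \rank A)%N.
Proof.
move=> BA0; rewrite dim_vquot dimvf /dim /= dim_lker_mxfun; congr (_ - _)%N.
pose i := linfun (vsval : subvs_of (lker (mxfun B)) -> 'cV[F]_n).
have iE x : i x = vsval x by rewrite lfunE.
rewrite -(dim_limg_mxfun A) -/i.
have ker0 : ((i @^-1: limg (mxfun A)) :&: lker i)%VS = 0%VS.
  apply/eqP; rewrite -subv0; apply/subvP=> x /memv_capP[_].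
  by rewrite memv_ker iE memv0 -val_eqE.
rewrite -(limg_dim_eq ker0) lpreimK //.
apply/subvP=> y /memv_imgP[x _ ->].
have xk : mxfun A x \in lker (mxfun B).
  by rewrite memv_ker !mxfunE mulmxA BA0 mul0mx.
by apply/memv_imgP; exists (Subvs xk); rewrite ?memvf // iE.
Qed.

End KernelDimension.

(** * Positive diagonal forms and the kernel of a weighted Laplacian *)

Section WeightedForm.
Variable R : realType.

Lemma diag_form_ge0 n (w : 'rV[R]_n) (x : 'cV[R]_n) :
  (forall i, 0 < w 0 i) -> 0 <= (x^T *m diag_mx w *m x) 0 0.
Proof.
move=> w0; rewrite mxE sumr_ge0 // => i _; rewrite mul_mx_diag !mxE mulrAC -expr2.
by rewrite mulr_ge0 ?sqr_ge0 // ltW.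
Qed.

Lemma diag_form_eq0 n (w : 'rV[R]_n) (x : 'cV[R]_n) :
  (forall i, 0 < w 0 i) -> (x^T *m diag_mx w *m x) 0 0 = 0 -> x = 0.
Proof.
move=> w0; rewrite mxE.
under eq_bigr => i _ do rewrite mul_mx_diag !mxE mulrAC -expr2.
move/eqP; rewrite psumr_eq0; last first.
  by move=> i _; rewrite mulr_ge0 ?sqr_ge0 // ltW.
move=> /allP x0; apply/colP=> i; rewrite [RHS]mxE; apply/eqP.
have := x0 i (mem_index_enum i).
by rewrite /= mulf_eq0 sqrf_eq0 (gt_eqF (w0 i)) orbF.
Qed.

Lemma diag_mx_unit n (w : 'rV[R]_n) :
  (forall i, 0 < w 0 i) -> diag_mx w \in unitmx.
Proof.
move=> w0; rewrite unitmxE det_diag unitfE prodf_seq_neq0.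
by apply/allP=> i _ /=; rewrite gt_eqF.
Qed.

(** Exhibits the inverse weights as positive diagonal entries, so that the form in the second
    summand is also definite. *)
Lemma invmx_diag n (w : 'rV[R]_n) : (forall i, 0 < w 0 i) ->
  invmx (diag_mx w) = diag_mx (\row_i (w 0 i)^-1).
Proof.
move=> w0; have U := diag_mx_unit w0.
rewrite -[RHS]mul1mx -(mulVmx U) -mulmxA mulmx_diag.
suff -> : diag_mx (\row_i (w 0 i * (\row_i0 (w 0 i0)^-1) 0 i)) = 1%:M.
  by rewrite mulmx1.
by apply/matrixP=> i j; rewrite !mxE divff // gt_eqF.
Qed.

(** Linear algebra only, to be applied with [A] as d_k and [B] as d_(k-1). *)
Lemma dim_ker_weighted_laplacian m n p (A : 'M[R]_(m, n)) (B : 'M[R]_(n, p))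
    (w : 'rV[R]_n) (wp : 'rV[R]_p) (wn : 'rV[R]_m) :
  (forall i, 0 < w 0 i) -> (forall i, 0 < wp 0 i) -> (forall i, 0 < wn 0 i) ->
  A *m B = 0 ->
  \dim (lker (mxfun (invmx (diag_mx w) *m A^T *m diag_mx wn *m A
     + B *m invmx (diag_mx wp) *m B^T *m diag_mx w)))
  = (n - \rank A - \rank B)%N.
Proof.
move=> w0 wp0 wn0 AB; set L := _ + _; set W := diag_mx w.
have UW : W \in unitmx := diag_mx_unit w0.
have WT : W^T = W by exact: tr_diag_mx.
have kerL : lker (mxfun L) = lker (mxfun (col_mx A (B^T *m W))).
  apply/vspaceP=> x; rewrite !memv_ker !mxfunE mul_col_mx.
  apply/eqP/eqP => [Lx|/eqP]; last first.
    rewrite col_mx_eq0 => /andP[/eqP Ax /eqP Bx].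
    by rewrite mulmxDl -!mulmxA Ax [B^T *m _]mulmxA Bx !mulmx0 addr0.
  have E : ((A *m x)^T *m diag_mx wn *m (A *m x)) 0 0
     + ((B^T *m W *m x)^T *m diag_mx (\row_i (wp 0 i)^-1) *m (B^T *m W *m x)) 0 0
     = 0.
    have : (x^T *m W *m (L *m x)) 0 0 = 0 by rewrite Lx mulmx0 mxE.
    rewrite mulmxDl mulmxDr mxE => <-.
    congr (_ + _); apply: (congr1 (fun M : 'M_1 => M 0 0)).
      by rewrite !mulmxA mulmxK // trmx_mul.
    by rewrite -invmx_diag // !trmx_mul trmxK WT !mulmxA.
  have wpV i : 0 < (\row_i (wp 0 i)^-1) 0 i :> R by rewrite mxE invr_gt0.
  move/eqP: E; rewrite paddr_eq0 ?diag_form_ge0 // => /andP[/eqP EA /eqP EB].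
  by rewrite (diag_form_eq0 wn0 EA) (diag_form_eq0 wpV EB) col_mx0.
rewrite kerL dim_lker_mxfun -addsmxE.
have rB : \rank (B^T *m W) = \rank B by rewrite mxrankMfree ?row_free_unit ?mxrank_tr.
(* The rank of the stacked matrix is the sum of the two ranks once the row spaces meet trivially. *)
suff cap0 : (A :&: (B^T *m W))%MS = 0.
  by have := mxrank_sum_cap A (B^T *m W); rewrite cap0 mxrank0 addn0 rB => ->; rewrite subnDA.
apply/eqP/rowV0P=> y; rewrite sub_capmx => /andP[/submxP[u yu] /submxP[v yv]].
(* The squared [W]-norm of [B *m v^T] is [y *m B *m v^T], which vanishes because [y = u *m A] and
   [A *m B = 0]. *)
have Bv : B *m v^T = 0.
  apply: (diag_form_eq0 w0); rewrite -/W trmx_mul trmxK.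
  have -> : v *m B^T *m W *m (B *m v^T) = y *m (B *m v^T).
    by rewrite yv !mulmxA.
  by rewrite yu -!mulmxA (mulmxA A) AB mul0mx mulmx0 mxE.
have vB : v *m B^T = 0 by rewrite -[v]trmxK -trmx_mul Bv trmx0.
by rewrite yv mulmxA vB mul0mx.
Qed.

End WeightedForm.

(** * Comparison of harmonic cochains, cohomology and homology *)

Theorem proposition4p5 (R : realType) (V : finType) (K : {set {set V}})
    (o : {set V} -> seq V) (k : nat) :
  simplicial_complex K -> orientation K o ->
  (forall wp w wn : {set V} -> R,
     positive_weight K k wp -> positive_weight K k.+1 w ->
     positive_weight K k.+2 wn ->
     \dim (lker (mxfun (hodge_laplacian K o k wp w wn)))
       = \dim {: cohomology R K o k}
     /\ \dim {: cohomology R K o k} = betti R K o k)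
  /\
  (forall wp w wn wp' w' wn' : {set V} -> R,
     positive_weight K k wp -> positive_weight K k.+1 w ->
     positive_weight K k.+2 wn ->
     positive_weight K k wp' -> positive_weight K k.+1 w' ->
     positive_weight K k.+2 wn' ->
     \dim (lker (mxfun (hodge_laplacian K o k wp w wn)))
       = \dim (lker (mxfun (hodge_laplacian K o k wp' w' wn')))).
Proof.
move=> cK oK; have dd := coboundary_comp0 R k cK oK.
have bT m : boundary R K o m = (coboundary R K o m)^T.
  by apply/matrixP=> i j; rewrite !mxE.
have pos m (w : {set V} -> R) : positive_weight K m w ->
    forall i : 'I_#|simplices K m|, 0 < (\row_i w (enum_val i)) 0 i.
  by move=> w0 i; rewrite mxE w0 ?enum_valP.
(* The right-hand side does not mention the weights, which gives the independence claim. *)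
have kerE (wp w wn : {set V} -> R) :
    positive_weight K k wp -> positive_weight K k.+1 w ->
    positive_weight K k.+2 wn ->
    \dim (lker (mxfun (hodge_laplacian K o k wp w wn)))
      = (#|simplices K k.+1| - \rank (coboundary R K o k.+1)
         - \rank (coboundary R K o k))%N.
  by move=> /pos wp0 /pos w0 /pos wn0; exact: dim_ker_weighted_laplacian.
split=> [wp w wn wp0 w0 wn0|wp w wn wp' w' wn' *]; last by rewrite !kerE.
rewrite kerE // /betti /cohomology /homology !dim_homology_space //.
  (* Transposition exchanges the roles of the two maps, so the same ranks are subtracted in the
     opposite order. *)
  by rewrite !bT !mxrank_tr subnAC.
by rewrite !bT -trmx_mul dd trmx0.
Qed.
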